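(* Let $(T_1,\dots,T_n)$ be a doubly $Q$-commuting tuple of c.n.u. contractions acting on a Hilbert space $\mathcal{H}$. Then there exists a decomposition of $\mathcal{H}$ into an orthogonal sum of $2^n$ joint reducing subspaces $\mathcal{H}_1,\dots,\mathcal{H}_{2^n}$ for $T_1,\dots,T_n,Q$ such that the following hold. (1) $T_i|_{\mathcal{H}_j}$ is a fundamental c.n.u. contraction for $1\le i\le n$ and $1\le j\le 2^n$. (2) $\mathcal{H}_1$ is the largest closed subspace of $\mathcal{H}$ reducing each $T_i$ to a pure isometry. (3) $\mathcal{H}_{2^n}$ is the largest closed subspace of $\mathcal{H}$ reducing each $T_i$ to a c.n.i. contraction. (4) If $G_n$ is the set of all functions $g:\{1,\dots,n\}\to\{A_{shift},A_{cni}\}$, then for every $g\in G_n$ there corresponds a unique subspace $\mathcal{H}_{t(g)}$ ($1\le t(g)\le 2^n$) such that the $k$-th component of $(T_1|_{\mathcal{H}_{t(g)}},\dots,T_n|_{\mathcal{H}_{t(g)}})$ is of the type $g(k)$ for $1\le k\le n$ and $\mathcal{H}_{t(g)}$ is the largest such joint reducing subspace for $T_1,\dots,T_n,Q$. One or more members of $\{\mathcal{H}_j:1\le j\le 2^n\}$ may coincide with the trivial subspace $\{0\}$.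
   Context: All operators are bounded linear maps on complex Hilbert spaces; a contraction is an operator of norm at most $1$. A tuple $(T_1,\dots,T_n)$ of operators on $\mathcal{H}$ is doubly $Q$-commuting if there is a commuting family $Q=\{Q_{ij}\in\mathcal{B}(\mathcal{H}): Q_{ij}=Q_{ji}^*,\ i\ne j\}$ of unitaries such that $T_iT_j=Q_{ij}T_jT_i$, $T_iT_j^*=Q_{ij}^*T_j^*T_i$ and $T_kQ_{ij}=Q_{ij}T_k$ for all $i\ne j$ and all $k$. A closed subspace is a joint reducing subspace for $T_1,\dots,T_n$ and $Q$ if it reduces every $T_i$ and every $Q_{ij}$. A contraction $T$ is completely non-unitary (c.n.u.), respectively completely non-isometry (c.n.i.), if there is no nonzero closed subspace that reduces $T$ and on which $T$ acts as a unitary, respectively an isometry. A pure isometry (unilateral shift) is an isometry $V$ with $V^{*n}x\to0$ for every $x$. A fundamental c.n.u. contraction is a contraction that is either a pure isometry (type $A_{shift}$) or a c.n.i. contraction (type $A_{cni}$). An operator on the zero space is allowed to be of either type. *)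

(* Defs.v *)
From HB Require Import structures.
From mathcomp Require Import all_boot all_order all_algebra.
From mathcomp Require Import complex.
From mathcomp Require Import all_classical all_reals all_analysis.

Set Implicit Arguments.
Unset Strict Implicit.
Unset Printing Implicit Defensive.

Import Order.TTheory GRing.Theory Num.Theory.
Import numFieldNormedType.Exports.

Local Open Scope classical_set_scope.
Local Open Scope ring_scope.
Local Open Scope complex_scope.

(* Complex Hilbert spaces. The inner product is linear in its first argument
   and conjugate-linear in the second one; [`|x|] takes its values in [R[i]]. *)
HB.mixin Record CompleteNormedModule_isHilbert (R : realType) H
    of CompleteNormedModule R[i] H := {
  inner : {dot H for (@Num.conj R[i])};
  sqr_normE : forall x : H, `|x| ^+ 2 = inner x x
}.

#[short(type="hilbertType")]
HB.structure Definition Hilbert (R : realType) :=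
  { H of CompleteNormedModule_isHilbert R H & CompleteNormedModule R[i] H }.

Section Operators.
Context {R : realType} {H : hilbertType R}.
Implicit Types (T U : {linear H -> H}) (M N : set H).

Definition bounded_operator T := bounded_near T (nbhs (0 : H)).

(* The adjoint of a bounded operator exists and is unique by the Riesz
   representation theorem; the value [fun=> 0] is only taken by unbounded
   linear maps without an everywhere defined adjoint. *)
Definition adjoint (T : H -> H) : H -> H :=
  xget (fun=> 0) [set S : H -> H | forall x y, inner (T x) y = inner x (S y)].

Definition closed_subspace M :=
  submod_closed (fun x : H => x \in M) /\ closed M.

Definition reduces T M :=
  forall x, M x -> M (T x) /\ M (adjoint T x).

(* The predicates [..._on T M] say that the restriction of T to the closed
   subspace M has the given property. They are meant for M reducing T, in which
   case the adjoint of the restriction is the restriction of the adjoint, and a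
   closed subspace N of M reduces the restriction if and only if it reduces T.
   For M = setT they are the properties of T itself. *)

Definition contraction_on T M := forall x, M x -> `|T x| <= `|x|.

Definition isometry_on T M := forall x, M x -> `|T x| = `|x|.

Definition unitary_on T M :=
  forall x, M x -> adjoint T (T x) = x /\ T (adjoint T x) = x.

Definition pure_isometry_on T M :=
  isometry_on T M /\
  forall x, M x -> iter m (adjoint T) x @[m --> \oo] --> (0 : H).

Definition cnu_contraction_on T M :=
  contraction_on T M /\
  forall N, closed_subspace N -> N `<=` M -> reduces T N -> unitary_on T N ->
    N = [set 0].

Definition cni_contraction_on T M :=
  contraction_on T M /\
  forall N, closed_subspace N -> N `<=` M -> reduces T N -> isometry_on T N ->
    N = [set 0].

Inductive fundamental_type := A_shift | A_cni.

Definition of_type_on (a : fundamental_type) T M :=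
  match a with
  | A_shift => pure_isometry_on T M
  | A_cni => cni_contraction_on T M
  end.

Definition fundamental_cnu_contraction_on T M :=
  contraction_on T M /\ (pure_isometry_on T M \/ cni_contraction_on T M).

(* A family Q indexed by pairs i != j: the diagonal entries are irrelevant. *)

Definition commuting_unitary_family (n : nat)
    (Q : 'I_n -> 'I_n -> {linear H -> H}) :=
  [/\ forall i j, i != j -> bounded_operator (Q i j) /\ unitary_on (Q i j) setT,
      forall i j, i != j -> Q i j =1 adjoint (Q j i) &
      forall i j k l, i != j -> k != l -> Q i j \o Q k l =1 Q k l \o Q i j].

Definition doubly_Q_commuting (n : nat) (T : 'I_n -> {linear H -> H})
    (Q : 'I_n -> 'I_n -> {linear H -> H}) :=
  [/\ forall i, bounded_operator (T i),
      commuting_unitary_family Q,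
      forall i j, i != j -> T i \o T j =1 Q i j \o T j \o T i,
      forall i j, i != j ->
        T i \o adjoint (T j) =1 adjoint (Q i j) \o adjoint (T j) \o T i &
      forall i j k, i != j -> T k \o Q i j =1 Q i j \o T k].

Definition joint_reducing (n : nat) (T : 'I_n -> {linear H -> H})
    (Q : 'I_n -> 'I_n -> {linear H -> H}) M :=
  [/\ closed_subspace M,
      forall i, reduces (T i) M &
      forall i j, i != j -> reduces (Q i j) M].

Definition orthogonal_decomposition (m : nat) (Hs : 'I_m -> set H) :=
  [/\ forall j, closed_subspace (Hs j),
      forall j k, j != k ->
        forall x y, Hs j x -> Hs k y -> inner x y = 0 &
      forall x, exists2 y : 'I_m -> H,
        (forall j, Hs j (y j)) & x = \sum_(j < m) y j].

Definition largest_with (P : set H -> Prop) M :=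
  P M /\ forall N, P N -> N `<=` M.

End Operators.

(* Main.v *)
(* For each [T = T i], let [M i] be the orthogonal complement of the smallest set
   that contains the range of [1 - T^* T] and is stable under [T] and [T^*]: it is
   the largest reducing subspace on which [T] is an isometry. A c.n.u. isometry is
   pure, because on the complement in [M i] of the vectors [x] with
   [T^*m x --> 0] the operator is unitary; and [T] is c.n.i. on the complement of
   [M i]. The double Q-commutation relations carry words in [T i] and [T i^*]
   through [T j], [T j^*] and [Q k l] up to unitaries that cancel in [T^* T], so
   every [M i] reduces all the operators and the projections onto the [M i]
   commute. The summands are the intersections over [i] of [M i] or its
   complement, chosen according to the binary digits of the index. *)
Require Import Defs.
From HB Require Import structures.
From mathcomp Require Import all_boot all_order all_algebra.
From mathcomp Require Import complex.
From mathcomp Require Import all_classical all_reals all_analysis.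
From mathcomp Require Import ring lra.
Set Implicit Arguments.
Unset Strict Implicit.
Unset Printing Implicit Defensive.

Import Order.TTheory GRing.Theory Num.Theory.
Import numFieldNormedType.Exports.
Local Open Scope classical_set_scope.
Local Open Scope ring_scope.

(** * Inner product geometry, closed subspaces and orthogonal projection *)

Section HilbertSpace.
Context {R : realType} {H : hilbertType R}.
Implicit Types (x y z u v : H) (a : R[i]) (M N S : set H).

Lemma innerDl x y z : inner (x + y) z = inner x z + inner y z.
Proof. exact: linearDl. Qed.

Lemma innerDr x y z : inner z (x + y) = inner z x + inner z y.
Proof. exact: linearDr. Qed.

Lemma innerBl x y z : inner (x - y) z = inner x z - inner y z.
Proof. exact: linearBl. Qed.

Lemma innerBr x y z : inner z (x - y) = inner z x - inner z y.
Proof. exact: linearBr. Qed.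

Lemma innerZl a x y : inner (a *: x) y = a * inner x y.
Proof. exact: linearZl_LR. Qed.

Lemma innerZr a x y : inner x (a *: y) = a^* * inner x y.
Proof. exact: linearZr_LR. Qed.

Lemma inner0l x : inner 0 x = 0.
Proof. exact: linear0l. Qed.

Lemma inner0r x : inner x 0 = 0.
Proof. exact: linear0r. Qed.

Lemma innerC x y : inner x y = (inner y x)^*.
Proof. by rewrite hermC expr0 mul1r. Qed.

Lemma inner_eq0C x y : inner x y = 0 -> inner y x = 0.
Proof. by move=> xy; rewrite innerC xy conjC0. Qed.

Lemma inner_self_eq0 x : inner x x = 0 -> x = 0.
Proof. by move/eqP; rewrite dnorm_eq0 => /eqP. Qed.

Lemma inner_injr x y : (forall z, inner z x = inner z y) -> x = y.
Proof.
move=> xy; apply/eqP; rewrite -subr_eq0; apply/eqP; apply: inner_self_eq0.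
by rewrite innerBr xy subrr.
Qed.

(** The norm takes its values in [R[i]]; its real part lets order arguments, infima and [nra] work
    in [R]. *)
Definition rnorm x : R := complex.Re `|x|.

Lemma normE x : `|x| = (rnorm x)%:C%C.
Proof. by rewrite /rnorm RRe_real // normr_real. Qed.

Lemma rnorm_ge0 x : 0 <= rnorm x.
Proof. by rewrite -ler0c -normE. Qed.

Lemma le_rnormD x y : rnorm (x + y) <= rnorm x + rnorm y.
Proof. by rewrite -lecR rmorphD /= -!normE ler_normD. Qed.

Lemma rnormN x : rnorm (- x) = rnorm x.
Proof. by rewrite /rnorm normrN. Qed.

Lemma rnorm_distC x y : rnorm (x - y) = rnorm (y - x).
Proof. by rewrite -rnormN opprB. Qed.

Lemma rnorm0 : rnorm 0 = 0.
Proof. by rewrite /rnorm normr0. Qed.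

Lemma inner_rnorm x : inner x x = ((rnorm x) ^+ 2)%:C%C.
Proof. by rewrite -sqr_normE normE rmorphXn. Qed.

Lemma parallelogram x y :
  rnorm (x + y) ^+ 2 + rnorm (x - y) ^+ 2 = 2 * rnorm x ^+ 2 + 2 * rnorm y ^+ 2.
Proof.
have : inner (x + y) (x + y) + inner (x - y) (x - y) =
    (inner x x + inner x x) + (inner y y + inner y y).
  by rewrite dnormD dnormB; ring.
by rewrite !inner_rnorm -!rmorphD => /complexI; lra.
Qed.

(** [x - t *: y] is the component of [x] orthogonal to [y]; the loss in squared norm yields both
    Cauchy-Schwarz and the orthogonality of nearest points. *)
Lemma inner_residual x y (t := inner x y / inner y y) : y != 0 ->
  inner (x - t *: y) (x - t *: y) = inner x x - `|inner x y| ^+ 2 / inner y y.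
Proof.
rewrite -(dnorm_gt0 inner) => yy; rewrite dnormB dnormZ innerZr.
have -> : `|t| ^+ 2 * inner y y = `|inner x y| ^+ 2 / inner y y.
  rewrite /t normrM normfV exprMn exprVn (ger0_norm (ltW yy)).
  by field; rewrite gt_eqF.
have -> : t^* * inner x y = `|inner x y| ^+ 2 / inner y y.
  by rewrite /t rmorphM fmorphV /= (CrealP (gtr0_real yy)) normCK; ring.
have /CrealP -> : `|inner x y| ^+ 2 / inner y y \is Num.real.
  by rewrite realM ?realV ?(gtr0_real yy) // realX // normr_real.
by ring.
Qed.

Lemma cauchy_schwarz x y : `|inner x y| <= `|x| * `|y|.
Proof.
have [->|y0] := eqVneq y 0; first by rewrite inner0r normr0 mulr_ge0.
have := dnorm_ge0 inner (x - (inner x y / inner y y) *: y).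
rewrite inner_residual // subr_ge0 ler_pdivrMr ?dnorm_gt0 //.
rewrite -!sqr_normE -exprMn.
by rewrite ler_pXn2r ?nnegrE ?mulr_ge0.
Qed.

Definition adherent S x :=
  forall e : R, 0 < e -> exists2 s, S s & rnorm (x - s) < e.

Lemma closed_adherentP S : closed S <-> forall x, adherent S x -> S x.
Proof.
have adh x : adherent S x <-> closure S x.
  split=> [Sx B|Sx e e0].
    rewrite -nbhs_ballE => -[e e0 eB].
    have e0' : e \is Num.real by exact: gtr0_real.
    have [|s Ss xs] := Sx (complex.Re e); first by rewrite -ltcR RRe_real.
    exists s; split=> //; apply: eB; rewrite -ball_normE /ball_ /=.
    by rewrite normE -(RRe_real e0') ltcR.
  have [|s [Ss]] := Sx (ball x e%:C%C); first by apply: nbhsx_ballx; rewrite ltcR.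
  by rewrite -ball_normE /ball_ /= normE ltcR; exists s.
split=> [cS x /adh|Sadh x /adh]; first exact: cS.
exact: Sadh.
Qed.

Lemma closed_subspace_adherentP M : closed_subspace M <->
  [/\ M 0, forall a x y, M x -> M y -> M (a *: x + y) &
      forall x, adherent M x -> M x].
Proof.
split=> [[[M0 Ml] /closed_adherentP cM]|[M0 Ml /closed_adherentP cM]].
  split=> // [|a x y Mx My]; first by have := M0; rewrite inE.
  by have := Ml a x y; rewrite !inE; apply.
split=> //; split=> [|a x y]; rewrite !inE //; exact: Ml.
Qed.

Lemma rnorm_cauchy_cvg (u : nat -> H) :
  (forall e : R, 0 < e -> exists N : nat, forall k l, (N <= k)%N -> (N <= l)%N ->
    rnorm (u k - u l) < e) ->
  exists x, forall e : R, 0 < e ->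
    exists N : nat, forall k, (N <= k)%N -> rnorm (x - u k) < e.
Proof.
move=> cu.
have : cauchy (u @ \oo).
  apply/cauchy_ballP => e e0.
  have e0' : e \is Num.real by exact: gtr0_real.
  have [|N uN] := cu (complex.Re e); first by rewrite -ltcR RRe_real.
  exists (u @` [set k | (N <= k)%N], u @` [set k | (N <= k)%N]).
    by split; exists N => // k Nk; exists k.
  move=> [_ _] [/= [k Nk <-] [l Nl <-]].
  by rewrite -ball_normE /ball_ /= normE -(RRe_real e0') ltcR; apply: uN.
move/cauchy_cvg => /cvg_ex[x] /cvgrPdist_lt ux.
exists x => e e0; have [|N _ uN] := ux e%:C%C; first by rewrite ltcR.
by exists N => k /uN; rewrite /= normE ltcR.
Qed.

Lemma cvg_rnorm0P (u : nat -> H) :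
  u m @[m --> \oo] --> (0 : H) <->
  forall e : R, 0 < e -> exists N : nat, forall k, (N <= k)%N -> rnorm (u k) < e.
Proof.
split=> [/cvgr0Pnorm_lt u0 e e0|u0].
  have [|N _ uN] := u0 e%:C%C; first by rewrite ltcR.
  by exists N => k /uN; rewrite /= normE ltcR.
apply/cvgr0Pnorm_lt => e e0.
have e0' : e \is Num.real by exact: gtr0_real.
have [|N uN] := u0 (complex.Re e); first by rewrite -ltcR RRe_real.
by exists N => // k /= /uN; rewrite normE -(RRe_real e0') ltcR.
Qed.

Definition orth S := [set x | forall s, S s -> inner x s = 0].

Lemma orth_closed_subspace S : closed_subspace (orth S).
Proof.
apply/closed_subspace_adherentP; split=> [s _|a x y Sx Sy s Ss|x Sx s Ss].
- exact: inner0l.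
- by rewrite innerDl innerZl (Sx s Ss) (Sy s Ss) mulr0 addr0.
apply/eqP; rewrite -normr_eq0 eq_le normr_ge0 andbT.
rewrite -(RRe_real (normr_real (inner x s))) lecR.
apply/ler_addgt0Pr => e e0; rewrite add0r.
(* Cauchy-Schwarz bounds the modulus of [inner x s] by every [e > 0]; the [+ 1] keeps the divisor
   positive when [s = 0]. *)
have s1 : 0 < rnorm s + 1 by rewrite ltr_wpDl ?rnorm_ge0.
have [|y Sy] := Sx (e / (rnorm s + 1)); first by rewrite divr_gt0.
rewrite ltr_pdivlMr // => xye.
have -> : inner x s = inner (x - y) s by rewrite innerBl (Sy s Ss) subr0.
have := cauchy_schwarz (x - y) s.
rewrite !normE -(RRe_real (normr_real (inner _ _))) -rmorphM lecR.
by have := rnorm_ge0 (x - y); have := rnorm_ge0 s; nra.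
Qed.

Lemma subspace0 M : closed_subspace M -> M 0.
Proof. by case/closed_subspace_adherentP. Qed.

Lemma subspaceD M x y : closed_subspace M -> M x -> M y -> M (x + y).
Proof.
case/closed_subspace_adherentP=> _ Ml _ Mx My.
by rewrite -(scale1r x); exact: Ml.
Qed.

Lemma subspaceZ M a x : closed_subspace M -> M x -> M (a *: x).
Proof.
case/closed_subspace_adherentP=> M0 Ml _ Mx.
by rewrite -[_ *: _]addr0; exact: Ml.
Qed.

Lemma subspaceB M x y : closed_subspace M -> M x -> M y -> M (x - y).
Proof.
move=> cM Mx My; rewrite -scaleN1r.
by apply: subspaceD => //; exact: subspaceZ.
Qed.

Lemma closed_subspace_bigcap I (D : set I) (F : I -> set H) :
  (forall i, D i -> closed_subspace (F i)) ->
  closed_subspace (\bigcap_(i in D) F i).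
Proof.
move=> cF; apply/closed_subspace_adherentP.
split=> [i Di|a x y Mx My i Di|x Mx i Di].
- by apply: subspace0; exact: cF.
- case/closed_subspace_adherentP: (cF i Di) => _ + _.
  by apply; [apply: Mx|apply: My].
- case/closed_subspace_adherentP: (cF i Di) => _ _; apply=> e e0.
  by have [s Ms xs] := Mx e e0; exists s => //; apply: Ms.
Qed.

Lemma closed_subspaceI M N :
  closed_subspace M -> closed_subspace N -> closed_subspace (M `&` N).
Proof.
move=> cM cN; have -> : M `&` N = \bigcap_b (if b then M else N).
  apply/seteqP; split=> [x [Mx Nx] []|x xMN] //.
  by split; [apply: (xMN true)|apply: (xMN false)].
by apply: closed_subspace_bigcap => -[].
Qed.

Lemma subspace_eq0 M :
  closed_subspace M -> (forall x, M x -> x = 0) -> M = [set 0].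
Proof.
move=> cM M0; apply/seteqP; split=> [x /M0 -> //|_ ->]; exact: subspace0.
Qed.

Lemma meet_orth_eq0 M x : M x -> orth M x -> x = 0.
Proof. by move=> Mx /(_ x Mx)/inner_self_eq0. Qed.

(** If [inner (x - y) m] were nonzero, moving [y] by [t *: m] would stay in [M] and come strictly
    closer to [x]. *)
Lemma nearest_point_orth M x y : closed_subspace M -> M y ->
  (forall m, M m -> rnorm (x - y) <= rnorm (x - m)) -> orth M (x - y).
Proof.
move=> cM My ymin m Mm; have [->|m0] := eqVneq m 0; first exact: inner0r.
pose t := inner (x - y) m / inner m m.
have : inner (x - y) (x - y) <= inner (x - y - t *: m) (x - y - t *: m).
  rewrite !inner_rnorm lecR lerXn2r ?nnegrE ?rnorm_ge0 //.
  rewrite -addrA -opprD; apply: ymin.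
  by apply: subspaceD => //; exact: subspaceZ.
rewrite inner_residual // lerDl oppr_ge0 pmulr_lle0 ?invr_gt0 ?dnorm_gt0 //.
move=> b0; apply/eqP; rewrite -normr_eq0 -sqrf_eq0 eq_le b0 /=.
by rewrite exprn_ge0.
Qed.

(** A sequence in [M] whose distances to [x] tend to the infimum [d] is Cauchy by the parallelogram
    law; its limit is a nearest point. *)
Lemma projection M x : closed_subspace M ->
  exists2 y, M y & orth M (x - y).
Proof.
move=> cM; pose D := [set rnorm (x - m) | m in M]; pose d := inf D.
have infD : has_inf D.
  split; first by exists (rnorm (x - 0)), 0 => //; exact: subspace0.
  by exists 0 => _ [m _ <-]; exact: rnorm_ge0.
have d_le m : M m -> d <= rnorm (x - m).
  by move=> Mm; apply: ge_inf; [case: infD|exists m].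
have d0 : 0 <= d.
  by apply: lb_le_inf => [|_ [m _ <-]]; [case: infD|exact: rnorm_ge0].
have app k : exists m, M m /\ rnorm (x - m) < d + k.+1%:R^-1.
  have k0 : 0 < k.+1%:R^-1 :> R by rewrite invr_gt0.
  by have [_ [m Mm <-] xm] := inf_adherent k0 infD; exists m.
have [u /all_and2[Mu xu]] := choice app.
have near_d (e : R) : 0 < e ->
    exists N : nat, forall k, (N <= k)%N -> rnorm (x - u k) < d + e.
  move=> e0; have [N _ Ne] := near_infty_natSinv_lt (PosNum e0).
  exists N => k Nk; apply: (lt_trans (xu k)); rewrite ltrD2l; exact: Ne.
have [e e0|y uy] := @rnorm_cauchy_cvg u.
  (* With both distances below [d + c], the parallelogram law bounds the squared distance of [u k]
     and [u l] by [4 (d + c)^2 - 4 d^2 = c (8 d + 4 c)]. This is below [e^2] once [c <= 1] and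
     [c (8 d + 4) < e^2]; the final division by 2 makes the inequality strict. *)
  have [|N uN] := near_d (Num.min 1 (e ^+ 2 / (8 * d + 4) / 2)).
    by rewrite lt_min ltr01 !divr_gt0 ?exprn_gt0 //; lra.
  exists N => k l /uN xk /uN xl.
  set c := Num.min _ _ in xk xl.
  have c1 : c <= 1 by rewrite ge_min lexx.
  have ce : c * (8 * d + 4) < e ^+ 2.
    have : c <= e ^+ 2 / (8 * d + 4) / 2 by rewrite ge_min lexx orbT.
    rewrite -mulrA -invfM ler_pdivlMr; last by lra.
    have := exprn_gt0 2 e0; nra.
  rewrite -(@ltr_pXn2r _ 2) ?nnegrE ?rnorm_ge0 ?ltW //.
  have := parallelogram (x - u k) (x - u l).
  have -> : x - u k - (x - u l) = - (u k - u l).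
    by rewrite opprB addrC addrA subrK opprB.
  rewrite rnormN.
  (* The midpoint of [u k] and [u l] lies in [M], so its distance to [x] is at least [d]. *)
  have -> : x - u k + (x - u l) = 2 *: (x - 2^-1 *: (u k + u l)).
    rewrite scalerBr scalerA divff ?pnatr_eq0 // scale1r scaler_nat mulr2n.
    by rewrite addrACA opprD.
  have -> : rnorm (2 *: (x - 2^-1 *: (u k + u l))) ^+ 2 =
      4 * rnorm (x - 2^-1 *: (u k + u l)) ^+ 2.
    rewrite scaler_nat mulr2n; move: (x - _) => v.
    by have := parallelogram v v; rewrite subrr rnorm0; lra.
  have : d <= rnorm (x - 2^-1 *: (u k + u l)).
    by apply: d_le; apply: subspaceZ => //; exact: subspaceD.
  have := rnorm_ge0 (x - u k); have := rnorm_ge0 (x - u l).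
  set A := rnorm (x - u k) in xk *; set B := rnorm (x - u l) in xl *.
  set C := rnorm _; set E := rnorm _ => B0 A0 dC eq.
  have A2 : A ^+ 2 <= (d + c) ^+ 2.
    by rewrite ler_pXn2r ?nnegrE ?(ltW xk) // (le_trans A0) // ltW.
  have B2 : B ^+ 2 <= (d + c) ^+ 2.
    by rewrite ler_pXn2r ?nnegrE ?(ltW xl) // (le_trans B0) // ltW.
  have C2 : d ^+ 2 <= C ^+ 2.
    by rewrite ler_pXn2r ?nnegrE // (le_trans d0).
  nra.
have My : M y.
  have [_ _] := (closed_subspace_adherentP M).1 cM; apply=> e /uy[N uN].
  by exists (u N) => //; exact: uN.
exists y => //; apply: nearest_point_orth => // m Mm.
apply: le_trans (d_le m Mm); apply/ler_addgt0Pr => e e0.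
have e2 : 0 < e / 2 by rewrite divr_gt0.
have [N uN] := near_d _ e2; have [N' uN'] := uy _ e2.
have := uN _ (leq_maxl N N'); have := uN' _ (leq_maxr N N').
set k := maxn _ _; rewrite rnorm_distC.
have := le_rnormD (x - u k) (u k - y); rewrite addrA subrK; lra.
Qed.

End HilbertSpace.

(** * Riesz representation and existence of adjoints *)

Section Adjoint.
Context {R : realType} {H : hilbertType R}.
Implicit Types (T U : {linear H -> H}) (x y z : H) (M N S : set H).

(** Carries an adjoint as an explicit map, which can be a bundled linear one, instead of the choice
    made by [adjoint]. *)
Definition adjoint_pair (T A : H -> H) :=
  forall x y, inner (T x) y = inner x (A y).

Lemma adjoint_pairC (T A : H -> H) : adjoint_pair T A -> adjoint_pair A T.
Proof. by move=> TA x y; rewrite innerC -TA -innerC. Qed.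

(** If [f x0] is nonzero, let [z] be the component of [x0] orthogonal to the kernel:
    [f z *: x - f x *: z] lies in the kernel, so its product with [z] vanishes, which determines
    [f x]. *)
Lemma riesz_representation (f : {linear H -> R[i]^o}) :
  closed_subspace [set x : H | f x = 0] -> exists y, forall x, f x = inner x y.
Proof.
move=> cK; have [[x0 fx0]|f0] := pselect (exists x, f x != 0); last first.
  exists 0 => x; rewrite inner0r; apply/eqP/negPn/negP => fx.
  by apply: f0; exists x.
have [p fp] := projection x0 cK.
set z := x0 - p => zK.
have fz : f z = f x0 by rewrite linearB /= fp subr0.
have zz : inner z z != 0.
  by apply: contraNneq fx0 => /inner_self_eq0 z0; rewrite -fz z0 linear0.
exists ((f z / inner z z)^* *: z) => x; rewrite innerZr conjCK.
have : inner z (f z *: x - f x *: z) = 0.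
  have fZ a u : f (a *: u) = a * f u by exact: linearZ.
  by apply: zK; rewrite /= linearB !fZ mulrC subrr.
move/inner_eq0C; rewrite innerBl !innerZl => /eqP; rewrite subr_eq0 => /eqP e.
by rewrite mulrAC e mulfK.
Qed.

Lemma bounded_operatorP T :
  bounded_operator T ->
  exists2 C : R, 0 < C & forall x, rnorm (T x) <= C * rnorm x.
Proof.
move=> /linear_boundedP/pinfty_ex_gt0[c c0 cT].
have cE : (complex.Re c)%:C%C = c by rewrite RRe_real // gtr0_real.
exists (complex.Re c) => [|x]; first by rewrite -ltcR cE.
by rewrite -lecR rmorphM /= -!normE cE; exact: cT.
Qed.

Lemma adjoint_pair_adjoint T A : adjoint_pair T A -> adjoint T = A.
Proof.
move=> TA; have TT : adjoint_pair T (adjoint T).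
  exact: (@xgetPex _ (fun=> 0) [set S | adjoint_pair T S] (ex_intro _ A TA)).
by apply/funext => y; apply: inner_injr => z; rewrite -TT TA.
Qed.

Lemma preimage_closed_subspace T M : bounded_operator T ->
  closed_subspace M -> closed_subspace (T @^-1` M).
Proof.
move=> /bounded_operatorP[C C0 TC] /closed_subspace_adherentP[M0 Ml Ma].
apply/closed_subspace_adherentP; split=> /= [|a u v Mu Mv|x Mx].
- by rewrite linear0.
- by rewrite linearP; exact: Ml.
- apply: Ma => e e0; have [|s Ms xs] := Mx (e / C); first by rewrite divr_gt0.
  exists (T s) => //; rewrite -linearB (le_lt_trans (TC _)) //.
  by rewrite mulrC -ltr_pdivlMr.
Qed.

(** Riesz is applied to [inner (T x) y] as a function of [x]; its kernel is the preimage under [T]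
    of the complement of [y], hence closed. *)
Lemma adjoint_exists T : bounded_operator T ->
  exists2 A : {linear H -> H}, adjoint_pair T A & adjoint T = A.
Proof.
move=> bT; have [A TA] : exists A : H -> H, adjoint_pair T A.
  suff /choice[A TA] : forall y, exists z, forall x, inner (T x) y = inner x z.
    by exists A => x y; exact: TA.
  move=> y; pose f x : R[i]^o := inner (T x) y.
  have flin : linear f by move=> a u v; rewrite /f linearP innerDl innerZl.
  pose F : {linear H -> R[i]^o} := HB.pack f (GRing.isLinear.Build _ _ _ _ _ flin).
  apply: (riesz_representation (f := F)).
  rewrite (_ : [set x : H | F x = 0] = T @^-1` (orth [set y])).
    exact/preimage_closed_subspace/orth_closed_subspace.
  by apply/seteqP; split=> [x /= Fx _ ->|x /= /(_ y erefl)].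
have Alin : linear A.
  move=> a u v; apply: inner_injr => z.
  by rewrite -TA !innerDr !innerZr !TA.
pose B : {linear H -> H} := HB.pack A (GRing.isLinear.Build _ _ _ _ _ Alin).
by exists B => //; exact: adjoint_pair_adjoint.
Qed.

End Adjoint.

(** * The isometric part of a contraction and its orthogonal complement *)

Section IsometricPart.
Context {R : realType} {H : hilbertType R}.
Variables T A : {linear H -> H}.
Hypothesis TA : adjoint_pair T A.
Implicit Types (x y z s : H) (M N : set H).

(** Only the orthogonal complement of this set matters, so no span or closure is taken, and proofs
    go by induction on words in [T] and [A]. *)
Inductive defect_orbit : set H :=
| Defect z : defect_orbit (z - A (T z))
| DefectT s : defect_orbit s -> defect_orbit (T s)
| DefectA s : defect_orbit s -> defect_orbit (A s).

Definition isometric_part : set H := orth defect_orbit.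

Local Notation D := defect_orbit.
Local Notation M := isometric_part.

Let AT : adjoint_pair A T := adjoint_pairC TA.

Lemma reducesE N : reduces T N <-> forall x, N x -> N (T x) /\ N (A x).
Proof. by rewrite /reduces (adjoint_pair_adjoint TA). Qed.

Lemma reduces_orth N : reduces T N -> reduces T (orth N).
Proof.
move=> /reducesE TN; apply/reducesE => x xN.
by split=> s /TN[Ts As]; [rewrite TA xN|rewrite AT xN].
Qed.

Lemma isometric_part_reduces : reduces T M.
Proof.
apply/reducesE => x xM; split=> s Ds.
- by rewrite TA; apply/xM/DefectA.
- by rewrite AT; apply/xM/DefectT.
Qed.

(** [1 - A T] is self-adjoint, so a vector orthogonal to its range lies in its kernel. *)
Lemma isometric_partK x : M x -> A (T x) = x.
Proof.
move=> xM; apply: inner_injr => z.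
apply/eqP; rewrite eq_sym -subr_eq0 -TA -AT -innerBl; apply/eqP/inner_eq0C.
exact/xM/Defect.
Qed.

(** Pairing [x] with [T s] or [A s] amounts to pairing [A x] or [T x] with [s], and these images
    stay in [N]. *)
Lemma subset_isometric_part N :
  reduces T N -> (forall x, N x -> A (T x) = x) -> N `<=` M.
Proof.
move=> /reducesE TN NK x Nx s Ds; elim: Ds x Nx => [z|{}s _ IH|{}s _ IH] x Nx.
- by rewrite innerBr -TA -AT NK // subrr.
- by rewrite -AT; apply/IH; case: (TN x Nx).
- by rewrite -TA; apply/IH; case: (TN x Nx).
Qed.

(** The projection onto a reducing [N] commutes with [T] and [A], so it maps the defect orbit into
    itself ([s1] is the image of [s]); being self-adjoint, it then preserves [M]. *)
Lemma isometric_part_component N x y : closed_subspace N -> reduces T N ->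
  N x -> orth N y -> M (x + y) -> M x.
Proof.
move=> cN TN Nx Ny xyM s Ds.
have /reducesE oN := reduces_orth TN; move/reducesE: TN => TN.
have [s1 [s2 [-> Ds1 Ns1 Ns2]]] :
    exists s1 s2, [/\ s = s1 + s2, D s1, N s1 & orth N s2].
  elim: Ds => [z|{}s _ [s1 [s2 [-> Ds1 Ns1 Ns2]]]|
                 {}s _ [s1 [s2 [-> Ds1 Ns1 Ns2]]]].
  - have [p Np zp] := projection z cN.
    exists (p - A (T p)), (z - p - A (T (z - p))); split.
    + by rewrite (linearB T) (linearB A) addrACA -opprD !subrKC.
    + exact: Defect.
    + by apply: subspaceB => //; case/TN: Np => /TN[].
    + apply: subspaceB (orth_closed_subspace _) _ _ => //.
      by case/oN: zp => /oN[].
  - exists (T s1), (T s2); rewrite linearD; split => //; first exact: DefectT.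
      by case/TN: Ns1.
    by case/oN: Ns2.
  - exists (A s1), (A s2); rewrite linearD; split => //; first exact: DefectA.
      by case/TN: Ns1.
    by case/oN: Ns2.
rewrite innerDr [inner x s2]inner_eq0C ?Ns2 // addr0.
by rewrite -(xyM _ Ds1) innerDl (Ny s1) // addr0.
Qed.

Lemma defect_orbit_commute (V : {linear H -> H}) s :
  {morph V : x / T x} -> {morph V : x / A x} -> D s -> D (V s).
Proof.
move=> VT VA; elim=> [z|{}s _ IH|{}s _ IH].
- by rewrite linearB /= VA VT; exact: Defect.
- by rewrite VT; exact: DefectT.
- by rewrite VA; exact: DefectA.
Qed.

(** It suffices that the adjoint [B] of [S] maps the defect orbit into itself. On generators the
    twists cancel: [B A T = A W B T = A W T V B = A T W V B = A T B]. *)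
Lemma isometric_part_quasi_commute (S B V W : {linear H -> H}) :
  adjoint_pair S B ->
  (forall x, B (T x) = T (V (B x))) -> (forall x, B (A x) = A (W (B x))) ->
  {morph V : x / T x} -> {morph V : x / A x} ->
  {morph W : x / T x} -> {morph W : x / A x} ->
  cancel V W -> forall x, M x -> M (S x).
Proof.
move=> SB BT BA VT VA WT WA VK x Mx s Ds; rewrite SB; apply: Mx.
elim: Ds => [z|{}s _ IH|{}s _ IH].
- rewrite linearB /= BA BT WT VK; exact: Defect.
- by rewrite BT; apply/DefectT/defect_orbit_commute.
- by rewrite BA; apply/DefectA/defect_orbit_commute.
Qed.

Hypothesis cT : contraction_on T setT.

Lemma contraction_rnorm x : rnorm (T x) <= rnorm x.
Proof. by rewrite -lecR -!normE; exact: cT. Qed.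

(** The square of the norm of [A x] is [inner (T (A x)) x], at most the product of the norms of
    [A x] and [x]; one factor is then divided out. *)
Lemma adjoint_contraction x : rnorm (A x) <= rnorm x.
Proof.
have [Ax0|] := leP (rnorm (A x)) 0; first exact: le_trans Ax0 (rnorm_ge0 _).
move=> Ax0; rewrite -(ler_pM2l Ax0).
have : `|inner (A x) (A x)| <= `|T (A x)| * `|x|.
  by rewrite -TA; exact: cauchy_schwarz.
rewrite inner_rnorm ger0_norm ?ler0c ?exprn_ge0 ?rnorm_ge0 // !normE.
rewrite -rmorphM lecR expr2 => /le_trans; apply.
by rewrite ler_wpM2r ?rnorm_ge0 // contraction_rnorm.
Qed.

(** Expanding the squared norm of [A (T x) - x] leaves that of [A (T x)] minus that of [T x], which
    is at most 0 because [A] is a contraction. *)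
Lemma isometry_onK N : isometry_on T N -> forall x, N x -> A (T x) = x.
Proof.
move=> TN x Nx; apply/eqP; rewrite -subr_eq0; apply/eqP/inner_self_eq0.
have TT : inner (T x) (T x) = inner x x by rewrite -!sqr_normE TN.
apply/eqP; rewrite eq_le dnorm_ge0 andbT dnormB (AT (T x) x) TT.
have /CrealP -> : inner x x \is Num.real by rewrite ger0_real ?dnorm_ge0.
rewrite opprD addrACA subrr addr0 subr_le0 -TT.
rewrite !inner_rnorm lecR ler_pXn2r ?nnegrE ?rnorm_ge0 //.
exact: adjoint_contraction.
Qed.

Lemma isometry_on_isometric_part : isometry_on T M.
Proof.
move=> x Mx; apply/eqP; rewrite -(@eqrXn2 _ 2) // !sqr_normE TA.
by rewrite isometric_partK.
Qed.

Lemma cni_on_orth_isometric_part : cni_contraction_on T (orth M).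
Proof.
split=> [x _|N cN NM TN iN]; first exact: cT.
apply: subspace_eq0 => // x Nx; apply: meet_orth_eq0 (NM x Nx).
by apply: subset_isometric_part TN _ x Nx; exact: isometry_onK.
Qed.

(** [N] meets [M] trivially by the c.n.i. property. The projection onto [N] of a vector of [M] stays
    in [M], so it vanishes. *)
Lemma cni_sub_orth_isometric_part N :
  closed_subspace N -> reduces T N -> cni_contraction_on T N -> N `<=` orth M.
Proof.
move=> cN TN [_ cniN].
have NM : N `&` M = [set 0].
  apply: cniN; first exact: closed_subspaceI (orth_closed_subspace _).
  - exact: subIsetl.
  - by move=> x [/TN[? ?] /isometric_part_reduces[? ?]].
  - by move=> x [_ /isometry_on_isometric_part].
move=> n Nn m Mm; have [p Np mp] := projection m cN.
have : (N `&` M) p.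
  split=> //; apply: isometric_part_component TN Np mp _ => //.
  by rewrite addrC subrK.
rewrite NM => p0; apply: inner_eq0C.
by move: mp; rewrite p0 subr0; apply.
Qed.

Lemma iter_linearD m x y : iter m A (x + y) = iter m A x + iter m A y.
Proof. by elim: m => //= m ->; rewrite linearD. Qed.

Lemma iter_linearZ m (a : R[i]) x : iter m A (a *: x) = a *: iter m A x.
Proof. by elim: m => //= m ->; rewrite linearZ. Qed.

Lemma rnorm_iter_adjoint m x : rnorm (iter m A x) <= rnorm x.
Proof. by elim: m => //= m IH; exact: le_trans (adjoint_contraction _) IH. Qed.

(** The shift part in the Wold decomposition of the isometry induced on [M]. *)
Definition stable_part : set H :=
  [set x | M x /\ iter m A x @[m --> \oo] --> (0 : H)].

Lemma stable_part_closed_subspace : closed_subspace stable_part.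
Proof.
have [M0 Ml Ma] := (closed_subspace_adherentP _).1 (orth_closed_subspace D).
apply/closed_subspace_adherentP; split=> [|a x y [Mx Ax] [My Ay]|x Sx].
- split=> //; apply/cvg_rnorm0P => e e0; exists 0%N => k _.
  by rewrite -(scale0r 0) iter_linearZ scale0r rnorm0.
- split; first exact: Ml.
  rewrite (_ : (fun _ => _) = fun m => a *: iter m A x + iter m A y); last first.
    by apply/funext => m; rewrite iter_linearD iter_linearZ.
  rewrite -[0]addr0 -[X in X + _](scaler0 _ a).
  by apply: cvgD => //; exact: cvgZr.
- split; first by apply: Ma => e /Sx[s [Ms _] xs]; exists s.
  apply/cvg_rnorm0P => e e0; have e2 : 0 < e / 2 by rewrite divr_gt0.
  have [s [_ /cvg_rnorm0P As] xs] := Sx _ e2; have [N AsN] := As _ e2.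
  exists N => k /AsN sk; rewrite -(subrK s x) iter_linearD.
  have := le_rnormD (iter k A (x - s)) (iter k A s).
  by have := rnorm_iter_adjoint k (x - s); lra.
Qed.

Lemma stable_part_reduces : reduces T stable_part.
Proof.
apply/reducesE => x [Mx /cvg_rnorm0P Ax].
have [MT MA] := (reducesE M).1 isometric_part_reduces x Mx.
split; split=> //; apply/cvg_rnorm0P => e /Ax[N AxN].
(* One power of [A] is spent on cancelling [T], hence the bound [N.+1]. *)
- by exists N.+1 => -[//|k] Nk; rewrite iterSr isometric_partK //; exact: AxN.
- by exists N => k Nk; rewrite -iterSr; apply: AxN; exact: leqW.
Qed.

(** For [y] in [M] orthogonal to [stable_part], [y - T (A y)] is killed by [A], hence stable, and
    also orthogonal to [stable_part], hence zero. So [T] is unitary there, and the c.n.u. hypothesis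
    makes that space trivial. *)
Lemma pure_isometry_on_isometric_part :
  cnu_contraction_on T setT -> pure_isometry_on T M.
Proof.
move=> [_ cnuT]; split; first exact: isometry_on_isometric_part.
rewrite (adjoint_pair_adjoint TA) => x Mx.
have oTs := (reducesE _).1 (reduces_orth stable_part_reduces).
have TM := (reducesE _).1 isometric_part_reduces.
have N0 : M `&` orth stable_part = [set 0].
  have cN : closed_subspace (M `&` orth stable_part).
    by apply: closed_subspaceI; exact: orth_closed_subspace.
  apply: cnuT => //; first by apply/reducesE => y [/TM[? ?] /oTs[? ?]].
  move=> y [My Ny]; rewrite (adjoint_pair_adjoint TA) isometric_partK //.
  split=> //; apply/eqP; rewrite eq_sym -subr_eq0; apply/eqP.
  have [MTAy _] := TM _ (TM _ My).2.
  have Mu : M (y - T (A y)) by apply: subspaceB (orth_closed_subspace _) _ _.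
  apply: (@meet_orth_eq0 _ _ stable_part); last first.
    apply: subspaceB (orth_closed_subspace _) _ _ => //.
    exact: (oTs _ (oTs _ Ny).2).1.
  split=> //; apply/cvg_rnorm0P => e e0; exists 1%N => -[//|k] _.
  rewrite iterSr linearB (isometric_partK (TM _ My).2) subrr.
  by rewrite -(scale0r 0) iter_linearZ scale0r rnorm0.
have [p Sp xp] := projection x stable_part_closed_subspace.
have : (M `&` orth stable_part) (x - p).
  by split=> //; apply: subspaceB (orth_closed_subspace _) _ _ => //; case: Sp.
by rewrite N0 => /eqP; rewrite subr_eq0 => /eqP ->; case: Sp.
Qed.

End IsometricPart.

(** * Binary digits of the indices of the summands *)

Definition bit (i j : nat) : bool := odd (j %/ 2 ^ i).

Lemma bit_addl i m j k : (i < m)%N -> bit i (j + k * 2 ^ m) = bit i j.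
Proof.
move=> im; have -> : (k * 2 ^ m = k * 2 ^ (m - i) * 2 ^ i)%N.
  by rewrite -mulnA -expnD subnK // ltnW.
rewrite /bit addnC divnMDl ?expn_gt0 // oddD oddM oddX subn_eq0 leqNgt im.
by rewrite andbF.
Qed.

Lemma bit_lt m j : (j < 2 ^ m)%N -> bit m j = false.
Proof. by move=> jm; rewrite /bit divn_small. Qed.

Lemma bit_add_exp m j : (j < 2 ^ m)%N -> bit m (j + 2 ^ m) = true.
Proof. by move=> jm; rewrite /bit divnDr // divn_small // divnn expn_gt0. Qed.

Lemma bit_ones i n : (i < n)%N -> bit i (2 ^ n).-1.
Proof.
(* The quotient by [2 ^ i] is then [2 ^ (n - i) - 1], which is odd because [i < n]. *)
move=> lt_in; have -> : ((2 ^ n).-1 = (2 ^ (n - i)).-1 * 2 ^ i + (2 ^ i).-1)%N.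
  have -> : (2 ^ n = 2 ^ (n - i) * 2 ^ i)%N by rewrite -expnD subnK // ltnW.
  have := expn_gt0 2 i; have := expn_gt0 2 (n - i).
  case: (2 ^ (n - i))%N (2 ^ i)%N => [|a] [|b] //= _ _.
  by rewrite addnC.
rewrite /bit divnMDl ?expn_gt0 // divn_small ?prednK ?expn_gt0 // addn0.
by rewrite -subn1 oddB ?expn_gt0 // oddX subn_eq0 leqNgt lt_in.
Qed.

Lemma bit_surj n (b : nat -> bool) :
  exists2 j, (j < 2 ^ n)%N & forall i, (i < n)%N -> bit i j = b i.
Proof.
elim: n => [|n [j jn jb]]; first by exists 0%N.
exists (j + b n * 2 ^ n)%N => [|i].
  rewrite expnS mul2n -addnn; case: (b n); first by rewrite mul1n ltn_add2r.
  by rewrite addn0 ltn_addr.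
rewrite ltnS leq_eqVlt => /predU1P[->|im]; last by rewrite bit_addl ?jb.
by case: (b n); [rewrite mul1n bit_add_exp|rewrite addn0 bit_lt].
Qed.

(** In the induction, the quotient by [2 ^ n] is the top digit and the remainder keeps the lower
    ones. *)
Lemma bit_inj n j k : (j < 2 ^ n)%N -> (k < 2 ^ n)%N ->
  (forall i, (i < n)%N -> bit i j = bit i k) -> j = k.
Proof.
elim: n j k => [|n IH] j k.
  by rewrite expn0 !ltnS !leqn0 => /eqP-> /eqP->.
move=> jn kn jk.
have low l i : (i < n)%N -> bit i (l %% 2 ^ n) = bit i l.
  by move=> lt_in; rewrite [in RHS](divn_eq l (2 ^ n)) addnC bit_addl.
have top l : (l < 2 ^ n.+1)%N -> (l %/ 2 ^ n)%N = bit n l.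
  rewrite expnS /bit -ltn_divLR ?expn_gt0 //; by case: (_ %/ _)%N => [|[]].
rewrite (divn_eq j (2 ^ n)) (divn_eq k (2 ^ n)) !top // jk //.
congr (_ + _)%N; apply: IH; rewrite ?ltn_mod ?expn_gt0 // => i lt_in.
by rewrite !low // jk // leqW.
Qed.

(** * Splitting a vector successively along several two-part decompositions *)

Section Decomposition.
Context {R : realType} {H : hilbertType R}.
Implicit Types (x y z : H) (M N : set H).

(** The second hypothesis says that the projection onto [N] preserves [M]; being self-adjoint, it
    also preserves the complement of [M]. *)
Lemma orth_component M N y z : closed_subspace N ->
  (forall p q, N p -> orth N q -> M (p + q) -> M p) ->
  N y -> orth N z -> orth M (y + z) -> orth M y.
Proof.
move=> cN MN Ny Nz yzM s Ms; have [p Np sp] := projection s cN.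
have Mp : M p by apply: (MN p (s - p)); rewrite // subrKC.
have := yzM _ Mp; rewrite innerDl (Nz p) // addr0 => yp.
by rewrite -(subrKC p s) innerDr yp add0r; exact/inner_eq0C/sp.
Qed.

(** One index is split at a time; the last clause of the hypothesis ensures that later splittings
    keep the memberships already obtained. *)
Lemma iterated_decomposition n (C : 'I_n -> bool -> set H) :
  (forall i x, exists y z, [/\ x = y + z, C i false y, C i true z &
    forall k b, C k b x -> C k b y /\ C k b z]) ->
  forall x, exists2 y : 'I_(2 ^ n) -> H,
    (forall (j : 'I_(2 ^ n)) i, C i (bit i j) (y j)) & x = \sum_(j < 2 ^ n) y j.
Proof.
move=> splitC x.
suff /(_ n (leqnn n))[y yC xy] : forall m, (m <= n)%N ->
    exists2 y : nat -> H,
      (forall j, (j < 2 ^ m)%N -> forall i : 'I_n, (i < m)%N -> C i (bit i j) (y j)) &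
      x = \sum_(0 <= j < 2 ^ m) y j.
  exists (fun j => y j) => [j i|]; first exact: yC.
  by rewrite xy big_mkord.
elim=> [_|m IH mn].
  by exists (fun=> x) => //; rewrite expn0 big_nat1.
have [y yC ->] := IH (ltnW mn).
have /choice[u /choice[v uv]] := fun j => splitC (Ordinal mn) (y j).
(* The two halves of piece [j] go to positions [j] and [j + 2 ^ m], which differ only in digit
   [m]. *)
exists (fun j => if (j < 2 ^ m)%N then u j else v (j - 2 ^ m)%N).
- move=> j jm i; rewrite ltnS leq_eqVlt => im.
  have [lt_jm|le_mj] := ltnP j (2 ^ m).
    have [_ uC _ uk] := uv j; move: im => /predU1P[im|im].
      by rewrite im bit_lt //; have -> : i = Ordinal mn by exact: val_inj.
    by case: (uk _ _ (yC j lt_jm i im)).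
  have lt_jm : (j - 2 ^ m < 2 ^ m)%N.
    by rewrite ltn_subLR // addnn -mul2n -expnS.
  rewrite -[in bit i j](subnK le_mj).
  have [_ _ vC vk] := uv (j - 2 ^ m)%N; move: im => /predU1P[im|im].
    by rewrite im bit_add_exp //; have -> : i = Ordinal mn by exact: val_inj.
  rewrite -[X in (_ + X)%N]mul1n bit_addl //.
  by case: (vk _ _ (yC _ lt_jm i im)).
- transitivity (\sum_(0 <= j < 2 ^ m) u j + \sum_(0 <= j < 2 ^ m) v j).
    by rewrite -big_split; apply: eq_bigr => j _; case: (uv j).
  rewrite expnS mul2n -addnn [RHS](@big_cat_nat _ _ _ (2 ^ m)) ?leq_addr //=.
  congr (_ + _); first by apply: eq_big_nat => j /andP[_ ->].
  rewrite -{2}[(2 ^ m)%N]add0n big_addn addnK; apply: eq_big_nat => j _.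
  by rewrite ltnNge leq_addl addnK.
Qed.

End Decomposition.

(** * Joint reduction by the isometric parts of a doubly Q-commuting tuple *)

Section DoublyQCommuting.
Context {R : realType} {H : hilbertType R} (n : nat).
Variables (T : 'I_n -> {linear H -> H}) (Q : 'I_n -> 'I_n -> {linear H -> H}).
Hypothesis hTQ : doubly_Q_commuting T Q.
Variable A : 'I_n -> {linear H -> H}.
Hypothesis TA : forall i, adjoint_pair (T i) (A i).
Implicit Types (i j k l : 'I_n) (x : H).

Lemma Q_adjoint_pair i j : i != j -> adjoint_pair (Q i j) (Q j i).
Proof.
case: hTQ => _ [bQ Qadj _] _ _ _ ij x y.
have [/adjoint_exists[B QB adjB] _] := bQ _ _ ij.
by rewrite QB -adjB -Qadj // eq_sym.
Qed.

Lemma QK i j : i != j -> cancel (Q i j) (Q j i).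
Proof.
move=> ij x; case: hTQ => _ [bQ Qadj _] _ _ _; rewrite Qadj 1?eq_sym //.
by have [_ /(_ x I)[]] := bQ _ _ ij.
Qed.

Lemma T_comm_Q i j k : i != j -> {morph Q i j : x / T k x}.
Proof. by case: hTQ => _ _ _ _ TQ ij x; have /= -> := TQ i j k ij x. Qed.

Lemma adjoint_comm_Q i j k : i != j -> {morph Q i j : x / A k x}.
Proof.
move=> ij x; apply: inner_injr => z; have ji : j != i by rewrite eq_sym.
by rewrite -(Q_adjoint_pair ji) -!TA -(Q_adjoint_pair ji) T_comm_Q.
Qed.

(** This and the next two relations put the unitary in the inner position expected by
    [isometric_part_quasi_commute]. *)
Lemma TT_comm i j x : i != j -> T i (T j x) = T j (Q i j (T i x)).
Proof.
by case: hTQ => _ _ TT _ _ ij; have /= -> := TT i j ij x; rewrite T_comm_Q.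
Qed.

Lemma AT_comm i j x : i != j -> A j (T i x) = T i (Q i j (A j x)).
Proof.
move=> ij; case: hTQ => _ [_ Qadj _] _ TAc _; have := TAc i j ij x.
rewrite /= (adjoint_pair_adjoint (TA j)) (adjoint_pair_adjoint (Q_adjoint_pair ij)).
by rewrite -T_comm_Q // => ->; rewrite QK // eq_sym.
Qed.

Lemma AA_comm i j x : i != j -> A j (A i x) = A i (Q j i (A j x)).
Proof.
move=> ij; apply: inner_injr => z.
by rewrite -!TA -(Q_adjoint_pair ij) -TA TT_comm.
Qed.

Let M i := isometric_part (T i) (A i).

(** For distinct indices, [T j] and [A j] both preserve [M i] by quasi-commutation, with the
    mutually inverse unitaries [Q i j] and [Q j i] as twists. *)
Lemma T_reduces_isometric_part i j : reduces (T j) (M i).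
Proof.
have [->|ji] := eqVneq j i; first exact: isometric_part_reduces.
have ij : i != j by rewrite eq_sym.
apply/(reducesE (TA j)) => x Mx; split.
- apply: (@isometric_part_quasi_commute _ _ _ _ _ (A j) (Q i j) (Q j i)) Mx => //.
  + by move=> y; exact: AT_comm.
  + by move=> y; exact: AA_comm.
  + exact: T_comm_Q.
  + exact: adjoint_comm_Q.
  + exact: T_comm_Q.
  + exact: adjoint_comm_Q.
  + exact: QK.
- apply: (@isometric_part_quasi_commute _ _ _ _ _ (T j) (Q j i) (Q i j)) Mx => //.
  + exact/adjoint_pairC.
  + by move=> y; exact: TT_comm.
  + by move=> y; rewrite -adjoint_comm_Q // AT_comm // T_comm_Q // QK.
  + exact: T_comm_Q.
  + exact: adjoint_comm_Q.
  + exact: T_comm_Q.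
  + exact: adjoint_comm_Q.
  + exact: QK.
Qed.

Lemma Q_reduces_isometric_part i k l : k != l -> reduces (Q k l) (M i).
Proof.
move=> kl; have lk : l != k by rewrite eq_sym.
apply/(reducesE (Q_adjoint_pair kl)) => x Mx; split.
- apply: (@isometric_part_quasi_commute _ _ _ _ _ (Q l k) idfun idfun) Mx => //.
  + exact: Q_adjoint_pair.
  + exact: T_comm_Q.
  + exact: adjoint_comm_Q.
- apply: (@isometric_part_quasi_commute _ _ _ _ _ (Q k l) idfun idfun) Mx => //.
  + exact: Q_adjoint_pair.
  + exact: T_comm_Q.
  + exact: adjoint_comm_Q.
Qed.

(** The digit 1 marks the c.n.i. side, so index 0 gives the all-shift summand and the all-ones index
    the all-c.n.i. one. *)
Definition type_part i (b : bool) : set H := if b then orth (M i) else M i.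

Lemma type_part_closed_subspace i b : closed_subspace (type_part i b).
Proof. by case: b; exact: orth_closed_subspace. Qed.

Lemma T_reduces_type_part i j b : reduces (T j) (type_part i b).
Proof.
case: b; last exact: T_reduces_isometric_part.
exact/(reduces_orth (TA j))/T_reduces_isometric_part.
Qed.

Lemma Q_reduces_type_part i k l b : k != l -> reduces (Q k l) (type_part i b).
Proof.
move=> kl; case: b; last exact: Q_reduces_isometric_part.
exact/(reduces_orth (Q_adjoint_pair kl))/Q_reduces_isometric_part.
Qed.

(** The splitting is the projection onto [M i]. As [M i] reduces every [T k], this projection
    preserves each [M k] and its complement. *)
Lemma type_part_split i x : exists y z,
  [/\ x = y + z, type_part i false y, type_part i true z &
      forall k b, type_part k b x -> type_part k b y /\ type_part k b z].
Proof.
have cM : closed_subspace (M i) by exact: orth_closed_subspace.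
have [y My xy] := projection x cM.
exists y, (x - y); split; rewrite ?subrKC // => k b Cx.
have comp p q : M i p -> orth (M i) q -> M k (p + q) -> M k p.
  apply: (isometric_part_component (TA k)) => //.
  exact: T_reduces_isometric_part.
suff Cy : type_part k b y.
  by split=> //; apply: subspaceB (type_part_closed_subspace k b) _ _.
move: Cx; rewrite -{1}(subrKC y x) /type_part; case: b; last exact: comp.
exact: (orth_component cM).
Qed.

End DoublyQCommuting.

(** * Heredity of the types and assembly of the decomposition *)

Lemma cni_contraction_on_subset (R : realType) (H : hilbertType R)
    (T : {linear H -> H}) (M N : set H) :
  N `<=` M -> cni_contraction_on T M -> cni_contraction_on T N.
Proof.
move=> NM [cT cniT]; split=> [x /NM|L cL LN]; first exact: cT.
by apply: cniT => // x /LN/NM.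
Qed.

Lemma pure_isometry_on_subset (R : realType) (H : hilbertType R)
    (T : {linear H -> H}) (M N : set H) :
  N `<=` M -> pure_isometry_on T M -> pure_isometry_on T N.
Proof. by move=> NM [iT sT]; split=> x /NM; [exact: iT|exact: sT]. Qed.

Definition is_cni (a : fundamental_type) : bool :=
  if a is A_cni then true else false.

Theorem theorem4p3 (R : realType) (H : hilbertType R) (n : nat)
    (T : 'I_n -> {linear H -> H}) (Q : 'I_n -> 'I_n -> {linear H -> H})
    (hTQ : doubly_Q_commuting T Q)
    (hT : forall i, cnu_contraction_on (T i) setT) :
  exists Hs : 'I_(2 ^ n) -> set H,
    [/\ orthogonal_decomposition Hs /\ (forall j, joint_reducing T Q (Hs j)),
        forall i j, fundamental_cnu_contraction_on (T i) (Hs j),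
        forall j : 'I_(2 ^ n), nat_of_ord j = 0%N ->
          largest_with (fun M => closed_subspace M /\
            forall i, reduces (T i) M /\ pure_isometry_on (T i) M) (Hs j),
        forall j : 'I_(2 ^ n), nat_of_ord j = (2 ^ n).-1 ->
          largest_with (fun M => closed_subspace M /\
            forall i, reduces (T i) M /\ cni_contraction_on (T i) M) (Hs j) &
        exists t : ('I_n -> fundamental_type) -> 'I_(2 ^ n),
          forall g : 'I_n -> fundamental_type,
            unique (largest_with (fun M => joint_reducing T Q M /\
              forall k, of_type_on (g k) (T k) M)) (Hs (t g))].
Proof.
have /choice[A TA] : forall i, exists B : {linear H -> H}, adjoint_pair (T i) B.
  move=> i; case: hTQ => bT _ _ _ _.
  by have [B TB _] := adjoint_exists (bT i); exists B.
pose C i b := type_part T A i b.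
have cT i : contraction_on (T i) setT by case: (hT i).
have typeC i a : of_type_on a (T i) (C i (is_cni a)).
  case: a; first exact: (pure_isometry_on_isometric_part (TA i) (cT i) (hT i)).
  exact: (cni_on_orth_isometric_part (TA i) (cT i)).
(* Maximality for one operator; the claims about largest subspaces follow since each [Hs j] is an
   intersection of such parts. *)
have maxC i a N : closed_subspace N -> reduces (T i) N ->
    of_type_on a (T i) N -> N `<=` C i (is_cni a).
  case: a => cN TN; last exact: (cni_sub_orth_isometric_part (TA i) cN TN).
  case=> iN _; apply: (subset_isometric_part (TA i)) => //.
  exact: (isometry_onK (TA i) (cT i)).
have typeS i a M N : N `<=` M -> of_type_on a (T i) M -> of_type_on a (T i) N.
  by case: a; [exact: pure_isometry_on_subset|exact: cni_contraction_on_subset].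
pose Hs (j : 'I_(2 ^ n)) := [set x | forall i, C i (bit i j) x].
have HsC j i : Hs j `<=` C i (bit i j) by move=> x; exact.
have cHs j : closed_subspace (Hs j).
  rewrite (_ : Hs j = \bigcap_i C i (bit i j)).
    by apply: closed_subspace_bigcap => i _; exact: type_part_closed_subspace.
  by apply/seteqP; split=> [x Hx i _|x Hx i]; exact: Hx.
have jrHs j : joint_reducing T Q (Hs j).
  split=> // [k x Hx|k l kl x Hx]; split=> i.
  - by case: (T_reduces_type_part hTQ TA k (Hx i)).
  - by case: (T_reduces_type_part hTQ TA k (Hx i)).
  - by case: (Q_reduces_type_part hTQ TA kl (Hx i)).
  - by case: (Q_reduces_type_part hTQ TA kl (Hx i)).
have typeHs (j : 'I_(2 ^ n)) (i : 'I_n) (a : fundamental_type) :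
    bit i j = is_cni a -> of_type_on a (T i) (Hs j).
  by move=> ja; apply: typeS (typeC i a); rewrite -ja; exact: HsC.
exists Hs; split.
- split=> //; split=> // [j k jk x y Hx Hy|x].
    (* Distinct indices differ in some digit [i], where one summand lies in the isometric part of
       [T i] and the other in its complement. *)
    have [i jki] : exists i : 'I_n, bit i j != bit i k.
      apply: contrapT => nijk; case/eqP: jk; apply/val_inj.
      apply: (bit_inj (ltn_ord j) (ltn_ord k)) => i lt_in.
      apply/eqP/negPn/negP => ijk.
      by apply: nijk; exists (Ordinal lt_in).
    have := Hx i; have := Hy i; rewrite /C /type_part.
    case: (bit i j) (bit i k) jki => -[]//= _ My Mx; first exact: Mx.
    exact/inner_eq0C/My.
  have [y yC xy] := iterated_decomposition (type_part_split hTQ TA) x.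
  by exists y.
- move=> i j; split=> [x _|]; first exact: cT.
  case ij: (bit i j); first by right; exact: (typeHs j i A_cni).
  by left; exact: (typeHs j i A_shift).
- move=> j j0; have bj i : bit i j = false by rewrite j0 /bit div0n.
  split=> [|N [cN TN] x Nx i].
    split=> // i; split; last exact: (typeHs j i A_shift (bj i)).
    by case: (jrHs j).
  by rewrite bj; have [? ?] := TN i; exact: (maxC i A_shift N).
- move=> j j1; have bj (i : 'I_n) : bit i j by rewrite j1 bit_ones.
  split=> [|N [cN TN] x Nx i].
    split=> // i; split; last exact: (typeHs j i A_cni (bj i)).
    by case: (jrHs j).
  by rewrite bj; have [? ?] := TN i; exact: (maxC i A_cni N).
- have /choice[t tP] : forall g : 'I_n -> fundamental_type, exists j : 'I_(2 ^ n),
      forall i : 'I_n, bit i j = is_cni (g i).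
    move=> g.
    (* [bit_surj] takes digits indexed by [nat]; the default [false] occurs only at positions from
       [n] on, which are never read. *)
    pose b k := if insub k is Some i then is_cni (g i) else false.
    have [j jn jb] := bit_surj n b; exists (Ordinal jn) => i.
    by rewrite jb // /b valK.
  exists t => g.
  have lt : largest_with (fun M => joint_reducing T Q M /\
      forall k, of_type_on (g k) (T k) M) (Hs (t g)).
    split=> [|N [[cN TN QN] gN] x Nx i]; last by rewrite tP; exact: (maxC i (g i) N).
    by split=> // k; apply: typeHs; rewrite tP.
  split=> // M [PM maxM]; case: lt => PH maxH; apply/seteqP; split.
    exact: maxM.
  exact: maxH.
Qed.
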